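(* The scheme $\Gamma$ associated to the algebra $TV/(R)=A(\alpha,\beta,\gamma)$ is finite if and only if $\alpha\beta\gamma\neq0$ and $\alpha+\beta+\gamma+\alpha\beta\gamma\neq0$.
   Context: $\Bbbk$ is a field of characteristic not $2$ containing a square root of $-1$; the parameters $\alpha,\beta,\gamma\in\Bbbk$ are assumed to have square roots in $\Bbbk$. $V$ is the $4$-dimensional vector space with basis $x_0,x_1,x_2,x_3$, $TV$ its tensor algebra, and $A(\alpha,\beta,\gamma)=TV/(R)$ where $R\subseteq V^{\otimes2}$ is the span of the six elements $$x_0\otimes x_1-x_1\otimes x_0-\alpha(x_2\otimes x_3+x_3\otimes x_2),\qquad x_0\otimes x_1+x_1\otimes x_0-x_2\otimes x_3+x_3\otimes x_2,$$ $$x_0\otimes x_2-x_2\otimes x_0-\beta(x_3\otimes x_1+x_1\otimes x_3),\qquad x_0\otimes x_2+x_2\otimes x_0-x_3\otimes x_1+x_1\otimes x_3,$$ $$x_0\otimes x_3-x_3\otimes x_0-\gamma(x_1\otimes x_2+x_2\otimes x_1),\qquad x_0\otimes x_3+x_3\otimes x_0-x_1\otimes x_2+x_2\otimes x_1.$$ Elements of $V$ are linear forms on $\mathbb P(V^* )\cong\mathbb P^3$, and elements of $V\otimes V$ are viewed as forms of bi-degree $(1,1)$ on $\mathbb P(V^* )\times\mathbb P(V^* )$. $\Gamma\subseteq\mathbb P(V^* )\times\mathbb P(V^* )$ is the scheme-theoretic zero locus of $R$. *)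

(* Defs.v *)
From HB Require Import structures.
From mathcomp Require Import all_boot all_order all_algebra.
From mathcomp Require Import mpoly.

Set Implicit Arguments.
Unset Strict Implicit.
Unset Printing Implicit Defensive.

Import GRing.Theory.
Local Open Scope ring_scope.

Section FiniteQuotient.
Variables (k : fieldType) (A : comAlgType k).

(* [p] lies in the ideal of [A] generated by the elements satisfying [E]. *)
Definition in_ideal (E : A -> Prop) (p : A) : Prop :=
  exists2 s : seq (A * A),
    (forall u, u \in s -> E u.2) & p = \sum_(u <- s) u.1 * u.2.

(* The k-algebra A / (E) is finite-dimensional: finitely many elements of [A]
   span [A] modulo the ideal generated by [E]. *)
Definition finite_dim_quotient (E : A -> Prop) : Prop :=
  exists s : seq A, forall p : A, exists c : 'I_(size s) -> k,
    in_ideal E (p - \sum_(l < size s) c l *: s`_l).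

End FiniteQuotient.

Section Gamma.
Variable k : fieldType.

(* V = k^4 is ['rV[k]_4] with its standard basis, and V (x) V is ['M[k]_4],
   the coefficient of x_a (x) x_b being the (a, b) entry. *)
Definition x (a : 'I_4) : 'rV[k]_4 := delta_mx 0 a.
Definition tens (u v : 'rV[k]_4) : 'M[k]_4 := u^T *m v.
Local Notation "u ⊗ v" := (tens u v) (at level 40, left associativity).

Definition relations (alpha beta gamma : k) : seq 'M[k]_4 :=
  [:: x 0 ⊗ x 1 - x 1 ⊗ x 0 - alpha *: (x 2 ⊗ x 3 + x 3 ⊗ x 2);
      x 0 ⊗ x 1 + x 1 ⊗ x 0 - x 2 ⊗ x 3 + x 3 ⊗ x 2;
      x 0 ⊗ x 2 - x 2 ⊗ x 0 - beta *: (x 3 ⊗ x 1 + x 1 ⊗ x 3);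
      x 0 ⊗ x 2 + x 2 ⊗ x 0 - x 3 ⊗ x 1 + x 1 ⊗ x 3;
      x 0 ⊗ x 3 - x 3 ⊗ x 0 - gamma *: (x 1 ⊗ x 2 + x 2 ⊗ x 1);
      x 0 ⊗ x 3 + x 3 ⊗ x 0 - x 1 ⊗ x 2 + x 2 ⊗ x 1].

Definition R (alpha beta gamma : k) : {vspace 'M[k]_4} :=
  <<relations alpha beta gamma>>%VS.

(* The bihomogeneous coordinate ring of P(V^* ) x P(V^* ) is k[X_0..X_3,Y_0..Y_3]
   with X_a, Y_a the coordinate x_a on the first, resp. second, factor. *)
Definition X (a : 'I_4) : {mpoly k[4 + 4]} := 'X_(lshift 4 a).
Definition Y (b : 'I_4) : {mpoly k[4 + 4]} := 'X_(rshift 4 b).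

Definition form11 (r : 'M[k]_4) : {mpoly k[4 + 4]} :=
  \sum_(a < 4) \sum_(b < 4) r a b *: (X a * Y b).

(* The zero locus of [W] meets the standard affine open {X_i <> 0} x {Y_j <> 0}
   in the spectrum of the quotient of k[X_0..X_3,Y_0..Y_3] by the following
   elements; setting X_i = Y_j = 1 replaces X_a by X_a / X_i and Y_b by Y_b / Y_j. *)
Definition chart_eqs (W : {vspace 'M[k]_4}) (i j : 'I_4)
    (q : {mpoly k[4 + 4]}) : Prop :=
  (exists2 r, r \in W & q = form11 r) \/ q = X i - 1 \/ q = Y j - 1.

(* Finiteness over k of the scheme-theoretic zero locus of [W]: a k-scheme with
   a finite affine open cover is finite over k iff the coordinate ring of each
   member of the cover is a finite-dimensional k-algebra. *)
Definition finite_zero_locus (W : {vspace 'M[k]_4}) : Prop :=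
  forall i j : 'I_4, finite_dim_quotient (chart_eqs W i j).

End Gamma.

(* Main.v *)
Require Import Defs.
From mathcomp Require Import all_boot all_order all_algebra.
From mathcomp Require Import fieldext mpoly ring.

Set Implicit Arguments.
Unset Strict Implicit.
Unset Printing Implicit Defensive.
Import GRing.Theory.
Local Open Scope ring_scope.

(** Write x_a and y_b for the coordinates on the two factors, S for
    al + be + ga + al be ga, and, on the locus where no coordinate vanishes,
    t_a = y_a / x_a.

    Finiteness.  Each of the three pairs of relations involves four products
    only; for the first pair they are x0 y1, x1 y0, x2 y3, x3 y2.  Eliminating
    the ratio x0 x1 / x2 x3 from that pair gives N1 = al D1 with
      N1 = (t1 - t0) (t3 - t2),   D1 = (t3 + t2) (t1 + t0),
    and the other two pairs give N2 = be D2 and N3 = ga D3 by cyclic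
    permutation of the indices 1, 2, 3.  These forms satisfy the addition law
      N1 D2 D3 + D1 N2 D3 + D1 D2 N3 + N1 N2 N3 = 0,
    so S D1 D2 D3 = 0 (product_relation).  If S is not zero, some t_a + t_b
    vanishes, which forces (t0 : t1 : t2 : t3) to be a sign vector with product
    -1 (fin_codim_pair).  There are four of these up to a common sign; for each
    of them the relations become x0 x1 = p x2 x3, x0 x2 = q x3 x1,
    x0 x3 = r x1 x2 with p q, q r, r p nonzero squares in k, and these
    have four solutions, all rational (fin_codim_orbit).  If some x_a vanishes,
    a linear system with determinant a multiple of S shows that only the four
    points with x = y a basis vector remain (fin_codim_x).

    All of this is carried out modulo ideals of the coordinate ring of a chart.
    A case distinction on the factors of a product g h that lies in the ideal I
    is legitimate because A / I is finite-dimensional as soon as A / (I, g) and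
    A / (I, h) are (fin_codim_split); at the end of each branch every
    coordinate is congruent to a scalar.

    Infiniteness.  If Gamma is finite, then the affine coordinates of any point
    of Gamma over any extension of k are algebraic over k
    (not_finite_of_transcendental).  It remains to find points with a
    transcendental coordinate.  If al = 0, the diagonal of the line x0 = x1 = 0
    lies in Gamma (line_point), and cyclically for be and ga.  If S = 0 and al,
    be, ga are not zero, the addition law makes the three equations N = al D
    dependent and they cut out a curve, on which t1 / t0 is a transcendental
    parameter; the remaining coordinates are found by extracting four square
    roots (quadratic_point, square_root_point). *)

(** * Finite-dimensional quotients and case distinctions on factors *)

Section Ideals.
Variables (k : fieldType) (A : comAlgType k).
Implicit Types (I J : A -> Prop) (p q u v g h : A).

Definition ideal I : Prop :=
  [/\ I 0, forall p q, I p -> I q -> I (p + q) & forall a p, I p -> I (a * p)].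

(** [finite_dim_quotient E] is [fin_codim (in_ideal E)].  Working with ideals as
    predicates allows them to be enlarged during a case distinction without
    forming quotient rings. *)
Definition fin_codim I : Prop :=
  exists s : seq A, forall p : A, exists c : 'I_(size s) -> k,
    I (p - \sum_(l < size s) c l *: s`_l).

(** Every membership proof below writes [p] as an explicit combination of known
    members and leaves the identity to [ring]; these lemmas set that up. *)
Lemma ideal_lin1 I : ideal I -> forall a u p, I u -> p = a * u -> I p.
Proof. by case=> _ _ IM a u p Iu ->; apply: IM. Qed.

Lemma ideal_lin2 I : ideal I -> forall a u b v p,
  I u -> I v -> p = a * u + b * v -> I p.
Proof. by case=> _ ID IM a u b v p Iu Iv ->; apply: ID; apply: IM. Qed.

Lemma ideal_lin3 I : ideal I -> forall a u b v c w p,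
  I u -> I v -> I w -> p = a * u + b * v + c * w -> I p.
Proof.
case=> _ ID IM a u b v c w p Iu Iv Iw ->.
exact: ID _ _ (ID _ _ (IM _ _ Iu) (IM _ _ Iv)) (IM _ _ Iw).
Qed.

Lemma ideal_lin4 I : ideal I -> forall a u b v c w d z p,
  I u -> I v -> I w -> I z -> p = a * u + b * v + c * w + d * z -> I p.
Proof.
case=> _ ID IM a u b v c w d z p Iu Iv Iw Iz ->.
exact: ID _ _ (ID _ _ (ID _ _ (IM _ _ Iu) (IM _ _ Iv)) (IM _ _ Iw)) (IM _ _ Iz).
Qed.

Lemma ideal_cancel I (c : k) p :
  ideal I -> c != 0 -> I (in_alg A c * p) -> I p.
Proof.
move=> idI c0 Icp; apply: (ideal_lin1 idI (a := in_alg A c^-1) Icp).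
by rewrite mulrA -rmorphM mulVf // rmorph1 mul1r.
Qed.

Lemma fin_codim_unit I : ideal I -> I 1 -> fin_codim I.
Proof.
move=> idI I1; exists [::] => p; exists (fun _ => 0); rewrite big_ord0 subr0.
by apply: (ideal_lin1 idI (a := p) I1); rewrite mulr1.
Qed.

Definition add_gen I g p : Prop := exists2 q, I q & exists a, p = q + a * g.

Lemma add_gen_ideal I g : ideal I -> ideal (add_gen I g).
Proof.
case=> I0 ID IM; split.
- by exists 0 => //; exists 0; ring.
- move=> _ _ [q Iq [a ->]] [q' Iq' [a' ->]]; exists (q + q'); first exact: ID.
  by exists (a + a'); ring.
- move=> a _ [q Iq [b ->]]; exists (a * q); first exact: IM.
  by exists (a * b); ring.
Qed.

Lemma add_gen_sub I g p : I p -> add_gen I g p.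
Proof. by exists p => //; exists 0; ring. Qed.

Lemma add_gen_mem I g : ideal I -> add_gen I g g.
Proof. by case=> I0 _ _; exists 0 => //; exists 1; ring. Qed.

(** As [g * h] lies in [I], multiplication by [g] maps A / (I, h) onto the kernel
    (I, g) / I of the projection from A / I to A / (I, g), so the dimensions of
    the two quotients add up to a bound for that of A / I. *)
Lemma fin_codim_split I g h : ideal I -> I (g * h) ->
  (forall J, ideal J -> (forall p, I p -> J p) -> J g -> fin_codim J) ->
  (forall J, ideal J -> (forall p, I p -> J p) -> J h -> fin_codim J) ->
  fin_codim I.
Proof.
move=> idI Igh fdg fdh.
have [s hs] := fdg _ (add_gen_ideal g idI) (@add_gen_sub I g) (add_gen_mem g idI).
have [t ht] := fdh _ (add_gen_ideal h idI) (@add_gen_sub I h) (add_gen_mem h idI).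
exists (s ++ map (fun q => q * g) t) => p.
have [c [q Iq [a pE]]] := hs p.
have [d [q' Iq' [a' aE]]] := ht a.
have sz : (size s + size t)%N = size (s ++ map (fun q => q * g) t).
  by rewrite size_cat size_map.
exists (fun l => match split (cast_ord (esym sz) l) with
                 | inl i => c i | inr j => d j end).
have -> : \sum_(l < size (s ++ map (fun q => q * g) t))
    (match split (cast_ord (esym sz) l) with inl i => c i | inr j => d j end)
      *: (s ++ map (fun q => q * g) t)`_l
  = \sum_(l < size s) c l *: s`_l + (\sum_(l < size t) d l *: t`_l) * g.
  rewrite (reindex (cast_ord sz)) /=; last first.
    by exists (cast_ord (esym sz)) => l _; rewrite ?cast_ordK ?cast_ordKV.
  under eq_bigr => l _ do rewrite cast_ordK.
  rewrite big_split_ord /=; congr (_ + _).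
    apply: eq_bigr => l _; case: splitP => [j /= lj|j /= lj].
      by rewrite nth_cat ltn_ord; congr (c _ *: _); apply/val_inj.
    by have := ltn_ord l; rewrite lj ltnNge leq_addr.
  rewrite mulr_suml; apply: eq_bigr => l _; case: splitP => [j /= lj|j /= lj].
    by have := ltn_ord j; rewrite -lj ltnNge leq_addr.
  rewrite nth_cat ltnNge leq_addr /= addKn (nth_map 0) // scalerAl.
  by congr (d _ *: _ * _); apply/val_inj => /=; apply/esym/(@addnI (size s)).
apply: (ideal_lin3 idI (a := 1) (b := g) (c := a') Iq Iq' Igh).
set S := \sum_(l < size s) _ in pE *; set T := \sum_(l < size t) _ in aE *.
have -> : p = q + a * g + S by rewrite -pE; ring.
have -> : a = q' + a' * h + T by rewrite -aE; ring.
ring.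
Qed.

End Ideals.

(** * The equations of Gamma and their cyclic symmetry *)

(** The values of the six relations at a pair of vectors over any ring: they
    serve both for the coordinate functions and for points over extensions of
    [k]. *)
Definition gamma_eqs (B : comNzRingType) (a b c : B) (x y : 'I_4 -> B) : seq B :=
  [:: x 0 * y 1 - x 1 * y 0 - a * (x 2 * y 3 + x 3 * y 2);
      x 0 * y 1 + x 1 * y 0 - x 2 * y 3 + x 3 * y 2;
      x 0 * y 2 - x 2 * y 0 - b * (x 3 * y 1 + x 1 * y 3);
      x 0 * y 2 + x 2 * y 0 - x 3 * y 1 + x 1 * y 3;
      x 0 * y 3 - x 3 * y 0 - c * (x 1 * y 2 + x 2 * y 1);
      x 0 * y 3 + x 3 * y 0 - x 1 * y 2 + x 2 * y 1].

(** The permutation 1 -> 2 -> 3 -> 1 carries the equations to those for the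
    parameters permuted in the same way; most statements below treat one index
    and reach the others through it. *)
Definition cyc (a : 'I_4) : 'I_4 := nth 0 [:: 0; 2; 3; 1] a.

Lemma I4_ind (P : 'I_4 -> Prop) : P 0 -> P 1 -> P 2 -> P 3 -> forall a, P a.
Proof.
move=> P0 P1 P2 P3 [[|[|[|[|//]]]] a4].
- by rewrite (_ : Ordinal a4 = 0) //; apply/val_inj.
- by rewrite (_ : Ordinal a4 = 1) //; apply/val_inj.
- by rewrite (_ : Ordinal a4 = 2) //; apply/val_inj.
- by rewrite (_ : Ordinal a4 = 3) //; apply/val_inj.
Qed.

Lemma cyc3 a : cyc (cyc (cyc a)) = a.
Proof. by move: a; apply: I4_ind. Qed.

Definition admissible (k : fieldType) (a b c : k) : Prop :=
  [/\ 2 != 0 :> k, a != 0, b != 0, c != 0 & a + b + c + a * b * c != 0].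

Lemma admissible_cyc (k : fieldType) (a b c : k) :
  admissible a b c -> admissible b c a.
Proof.
case=> n2 a0 b0 c0 s0; split=> //.
by rewrite (_ : _ + _ = a + b + c + a * b * c) //; ring.
Qed.

(** * Charts as abstract ideals *)

Section Charts.
(* [ring] recognizes [in_alg] as a morphism as long as it stays folded *)
#[local] Arguments GRing.in_alg : simpl never.
Variables (k : fieldType) (A : comAlgType k).
Implicit Types (I J : A -> Prop) (al be ga e : k) (x y : 'I_4 -> A).
Local Notation "c %:a" := (in_alg A c) (at level 2, format "c %:a").

(** What is used of the ideal of a chart.  Unlike an explicit list of
    generators, these properties are stable under enlarging [I] and under the
    cyclic symmetry.  [chart_ideal_gen] is what remains of the fact that the coordinates generate
    the polynomial ring. *)
Record chart_ideal I al be ga x y : Prop := ChartIdeal {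
  chart_ideal_ideal : ideal I;
  chart_ideal_x : exists i, I (x i - 1);
  chart_ideal_y : exists j, I (y j - 1);
  chart_ideal_eqs : forall n, I (gamma_eqs al%:a be%:a ga%:a x y)`_n;
  chart_ideal_gen : forall J, ideal J ->
    (forall i, exists c, J (x i - c%:a)) ->
    (forall j, exists c, J (y j - c%:a)) -> fin_codim J }.

Lemma chart_ideal_cyc I al be ga x y :
  chart_ideal I al be ga x y ->
  chart_ideal I be ga al (x \o cyc) (y \o cyc).
Proof.
case=> idI [i xi] [j yj] eqs gen; split=> //.
- by exists (cyc (cyc i)); rewrite /= cyc3.
- by exists (cyc (cyc j)); rewrite /= cyc3.
- case=> [|[|[|[|[|[|n]]]]]].
  + exact: (eqs 2).
  + exact: (eqs 3).
  + exact: (eqs 4).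
  + exact: (eqs 5).
  + exact: (eqs 0).
  + exact: (eqs 1).
  + by rewrite nth_default //; case: idI.
- move=> J idJ hx hy; apply: gen => // l.
    by have /= := hx (cyc (cyc l)); rewrite cyc3.
  by have /= := hy (cyc (cyc l)); rewrite cyc3.
Qed.

Lemma chart_ideal_sub I J al be ga x y :
  ideal J -> (forall p, I p -> J p) ->
  chart_ideal I al be ga x y -> chart_ideal J al be ga x y.
Proof.
move=> idJ sIJ [_ [i xi] [j yj] eqs gen]; split=> //.
- by exists i; apply: sIJ.
- by exists j; apply: sIJ.
- by move=> n; apply: sIJ.
Qed.

Lemma chart_split I al be ga x y g h :
  chart_ideal I al be ga x y -> I (g * h) ->
  (forall J, chart_ideal J al be ga x y -> (forall p, I p -> J p) -> J g ->
     fin_codim J) ->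
  (forall J, chart_ideal J al be ga x y -> (forall p, I p -> J p) -> J h ->
     fin_codim J) ->
  fin_codim I.
Proof.
move=> cI Igh fg fh; apply: (fin_codim_split (chart_ideal_ideal cI) Igh).
  by move=> J idJ sIJ Jg; apply: fg => //; apply: chart_ideal_sub cI.
by move=> J idJ sIJ Jh; apply: fh => //; apply: chart_ideal_sub cI.
Qed.

(** If [x i] and [y j] are 1 with [i] different from [j], then 1 lies in [I].  If
    [i = j], all other coordinates lie in [I]: this is the reduced point where
    both vectors are the [i]-th basis vector. *)
Lemma fin_codim_offdiag I al be ga x y : chart_ideal I al be ga x y ->
  (forall i j, i != j -> I (x i * y j)) -> fin_codim I.
Proof.
move=> cI off; have idI := chart_ideal_ideal cI.
have [i xi] := chart_ideal_x cI; have [j yj] := chart_ideal_y cI.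
have [ij|ij] := eqVneq i j; last first.
  apply: fin_codim_unit => //.
  apply: (ideal_lin3 idI (a := 1) (b := - y j) (c := -1) (off _ _ ij) xi yj).
  by ring.
rewrite -{}ij in yj; apply: (chart_ideal_gen cI idI) => a.
  have [->|ai] := eqVneq a i; first by exists 1; rewrite rmorph1.
  exists 0; apply: (ideal_lin2 idI (a := 1) (b := - x a) (off _ _ ai) yj).
  by ring.
have [->|] := eqVneq a i; first by exists 1; rewrite rmorph1.
rewrite eq_sym => ai; exists 0.
apply: (ideal_lin2 idI (a := 1) (b := - y a) (off _ _ ai) xi).
by ring.
Qed.

(** The first two relations are linear in the four products x0 y1, x1 y0, x2 y3,
    x3 y2, and can be solved for the last two because 2 al is invertible. *)
Lemma pair23_of_pair01 I al be ga x y : chart_ideal I al be ga x y ->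
  admissible al be ga -> I (x 0 * y 1) -> I (x 1 * y 0) ->
  I (x 2 * y 3) /\ I (x 3 * y 2).
Proof.
move=> cI [n2 a0 _ _ _] u v; have idI := chart_ideal_ideal cI.
have /= E1 := chart_ideal_eqs cI 0; have /= E2 := chart_ideal_eqs cI 1.
have c0 : 2 * al != 0 by rewrite mulf_neq0.
split; apply: (ideal_cancel idI c0).
  apply: (ideal_lin4 idI (a := 1 + al%:a) (b := al%:a - 1) (c := -1)
    (d := - al%:a) u v E1 E2).
  by ring.
apply: (ideal_lin4 idI (a := 1 - al%:a) (b := - al%:a - 1) (c := -1)
    (d := al%:a) u v E1 E2).
by ring.
Qed.

Lemma pair01_of_pair23 I al be ga x y : chart_ideal I al be ga x y ->
  admissible al be ga -> I (x 2 * y 3) -> I (x 3 * y 2) ->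
  I (x 0 * y 1) /\ I (x 1 * y 0).
Proof.
move=> cI [n2 _ _ _ _] u v; have idI := chart_ideal_ideal cI.
have /= E1 := chart_ideal_eqs cI 0; have /= E2 := chart_ideal_eqs cI 1.
split; apply: (ideal_cancel idI n2).
  apply: (ideal_lin4 idI (a := 1 + al%:a) (b := al%:a - 1) (c := 1)
    (d := 1) u v E1 E2).
  by ring.
apply: (ideal_lin4 idI (a := 1 - al%:a) (b := - al%:a - 1) (c := -1)
    (d := 1) u v E1 E2).
by ring.
Qed.

(** * The locus where some coordinate vanishes *)

Lemma fin_codim_xy0 I al be ga x y : chart_ideal I al be ga x y ->
  admissible al be ga -> I (x 0) -> I (y 0) -> fin_codim I.
Proof.
move=> cI nd x0 y0; have idI := chart_ideal_ideal cI.
have Ix b : I (x 0 * y b) by apply: (ideal_lin1 idI (a := y b) x0); ring.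
have Iy b : I (x b * y 0) by apply: (ideal_lin1 idI (a := x b) y0); ring.
have cI' := chart_ideal_cyc cI; have nd' := admissible_cyc nd.
have [u23 u32] := pair23_of_pair01 cI nd (Ix _) (Iy _).
have [u31 u13] := pair23_of_pair01 cI' nd' (Ix _) (Iy _).
have [u12 u21] := pair23_of_pair01 (chart_ideal_cyc cI')
  (admissible_cyc nd') (Ix _) (Iy _).
by apply: (fin_codim_offdiag cI); apply: I4_ind; apply: I4_ind.
Qed.

Lemma fin_codim_xy1 I al be ga x y : chart_ideal I al be ga x y ->
  admissible al be ga -> I (x 1) -> I (y 1) -> fin_codim I.
Proof.
move=> cI nd x1 y1; have idI := chart_ideal_ideal cI.
have Ix b : I (x 1 * y b) by apply: (ideal_lin1 idI (a := y b) x1); ring.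
have Iy b : I (x b * y 1) by apply: (ideal_lin1 idI (a := x b) y1); ring.
have cI' := chart_ideal_cyc cI; have nd' := admissible_cyc nd.
have [u23 u32] := pair23_of_pair01 cI nd (Iy _) (Ix _).
have [u02 u20] := pair01_of_pair23 cI' nd' (Iy _) (Ix _).
have [u03 u30] := pair01_of_pair23 (chart_ideal_cyc cI')
  (admissible_cyc nd') (Ix _) (Iy _).
by apply: (fin_codim_offdiag cI); apply: I4_ind; apply: I4_ind.
Qed.

(** Some [x i] is 1 in the chart. *)
Lemma ideal_of_squares I al be ga x y v : chart_ideal I al be ga x y ->
  (forall a, I (x a ^+ 2 * v)) -> I v.
Proof.
move=> cI Iv; have [i xi] := chart_ideal_x cI.
apply: (ideal_lin2 (chart_ideal_ideal cI) (a := 1) (b := - (x i + 1) * v)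
  (Iv i) xi).
by ring.
Qed.

(** When x0 = 0, the relations express x2 y3 through x1 y0 and x1 y3 through
    x2 y0; compare the two resulting expressions for x1 x2 y3. *)
Lemma x0_relation I al be ga x y : chart_ideal I al be ga x y -> I (x 0) ->
  I ((be * (1 - al))%:a * (x 1 ^+ 2 * y 0)
     - (al * (1 + be))%:a * (x 2 ^+ 2 * y 0)).
Proof.
move=> cI x0; have idI := chart_ideal_ideal cI.
have /= E1 := chart_ideal_eqs cI 0; have /= E2 := chart_ideal_eqs cI 1.
have /= E3 := chart_ideal_eqs cI 2; have /= E4 := chart_ideal_eqs cI 3.
have T23 : I ((2 * al)%:a * (x 2 * y 3) - (al - 1)%:a * (x 1 * y 0)).
  by apply: (ideal_lin3 idI (a := (1 + al%:a) * y 1) (b := -1) (c := - al%:a)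
    x0 E1 E2); ring.
have T13 : I ((2 * be)%:a * (x 1 * y 3) + (1 + be)%:a * (x 2 * y 0)).
  by apply: (ideal_lin3 idI (a := (1 - be%:a) * y 2) (b := -1) (c := be%:a)
    x0 E3 E4); ring.
by apply: (ideal_lin2 idI (a := be%:a * x 1) (b := - al%:a * x 2) T23 T13); ring.
Qed.

(** The relation above and its two cyclic images form a homogeneous linear
    system in the three products x_a ^ 2 y0.  Its determinant is proportional to
    (1 - al) (1 - be) (1 - ga) - (1 + al) (1 + be) (1 + ga), which equals -2
    times al + be + ga + al be ga. *)
Lemma x0_square_y0 I al be ga x y : chart_ideal I al be ga x y ->
  admissible al be ga -> I (x 0) -> I (x 1 ^+ 2 * y 0).
Proof.
move=> cI [n2 _ b0 c0 s0] x0; have idI := chart_ideal_ideal cI.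
have cI' := chart_ideal_cyc cI; have cI'' := chart_ideal_cyc cI'.
have r1 := x0_relation cI x0.
have /= r2 := x0_relation cI' x0.
have /= r3 := x0_relation cI'' x0.
have d0 : - 2 * be * ga * (al + be + ga + al * be * ga) != 0.
  by rewrite !mulf_neq0 // oppr_eq0.
apply: (ideal_cancel idI d0).
apply: (ideal_lin3 idI (a := ((1 - be) * (1 - ga) * ga)%:a)
  (b := (al * (1 + be) * (1 - ga))%:a)
  (c := (be * (1 + be) * (1 + ga))%:a) r1 r2 r3).
by ring.
Qed.

Lemma fin_codim_x0 I al be ga x y : chart_ideal I al be ga x y ->
  admissible al be ga -> I (x 0) -> fin_codim I.
Proof.
move=> cI nd x0; have idI := chart_ideal_ideal cI.
apply: (fin_codim_xy0 cI nd x0); apply: (ideal_of_squares cI).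
have cI' := chart_ideal_cyc cI; have nd' := admissible_cyc nd.
apply: I4_ind.
- by apply: (ideal_lin1 idI (a := x 0 * y 0) x0); ring.
- exact: x0_square_y0 cI nd x0.
- exact: x0_square_y0 cI' nd' x0.
- exact: x0_square_y0 (chart_ideal_cyc cI') (admissible_cyc nd') x0.
Qed.

(** When x1 = 0, eliminating y0, y2 and y3 leaves the two equations R1 and R2 in
    x2 ^ 2 y1 and x3 ^ 2 y1, with the same determinant
    (1 - al) (1 - be) (1 - ga) - (1 + al) (1 + be) (1 + ga) as for x0 = 0.
    Hence every x_a ^ 2 y1 vanishes, and so does y1. *)
Lemma fin_codim_x1 I al be ga x y : chart_ideal I al be ga x y ->
  admissible al be ga -> I (x 1) -> fin_codim I.
Proof.
move=> cI nd x1; have idI := chart_ideal_ideal cI.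
apply: (fin_codim_xy1 cI nd x1); apply: (ideal_of_squares cI).
case: nd => n2 _ _ _ s0.
have d0 : - 2 * (al + be + ga + al * be * ga) != 0.
  by rewrite !mulf_neq0 // oppr_eq0.
have /= E1 := chart_ideal_eqs cI 0; have /= E2 := chart_ideal_eqs cI 1.
have /= E3 := chart_ideal_eqs cI 2; have /= E4 := chart_ideal_eqs cI 3.
have /= E5 := chart_ideal_eqs cI 4; have /= E6 := chart_ideal_eqs cI 5.
have S1 : I ((1 - al)%:a * (x 2 * y 3) - (1 + al)%:a * (x 3 * y 2)).
  by apply: (ideal_lin3 idI (a := 2 * y 0) (b := 1) (c := -1) x1 E1 E2); ring.
have S2 : I (2 * (x 0 * y 1) - (1 + al)%:a * (x 2 * y 3)
             + (1 - al)%:a * (x 3 * y 2)).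
  by apply: (ideal_lin2 idI (a := 1) (b := 1) E1 E2); ring.
have A2 : I (2 * (x 0 * y 2) - (1 + be)%:a * (x 3 * y 1)).
  by apply: (ideal_lin3 idI (a := (be - 1)%:a * y 3) (b := 1) (c := 1)
    x1 E3 E4); ring.
have B2 : I (2 * (x 2 * y 0) - (1 - be)%:a * (x 3 * y 1)).
  by apply: (ideal_lin3 idI (a := - (be + 1)%:a * y 3) (b := -1) (c := 1)
    x1 E3 E4); ring.
have A3 : I (2 * (x 0 * y 3) + (1 - ga)%:a * (x 2 * y 1)).
  by apply: (ideal_lin3 idI (a := (1 + ga)%:a * y 2) (b := 1) (c := 1)
    x1 E5 E6); ring.
have B3 : I (2 * (x 3 * y 0) + (1 + ga)%:a * (x 2 * y 1)).
  by apply: (ideal_lin3 idI (a := (1 - ga)%:a * y 2) (b := -1) (c := 1)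
    x1 E5 E6); ring.
have R1 : I (((1 - al) * (1 - ga))%:a * (x 2 ^+ 2 * y 1)
             + ((1 + al) * (1 + be))%:a * (x 3 ^+ 2 * y 1)).
  by apply: (ideal_lin3 idI (a := - 2 * x 0) (b := (1 - al)%:a * x 2)
    (c := - (1 + al)%:a * x 3) S1 A3 A2); ring.
have R2 : I ((1 + ga)%:a * (x 2 ^+ 2 * y 1) + (1 - be)%:a * (x 3 ^+ 2 * y 1)).
  by apply: (ideal_lin2 idI (a := x 2) (b := - x 3) B3 B2); ring.
have U2 : I (x 2 ^+ 2 * y 1).
  apply: (ideal_cancel idI d0).
  by apply: (ideal_lin2 idI (a := (1 - be)%:a)
    (b := - ((1 + al) * (1 + be))%:a) R1 R2); ring.
have U3 : I (x 3 ^+ 2 * y 1).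
  apply: (ideal_cancel idI d0).
  by apply: (ideal_lin2 idI (a := - (1 + ga)%:a)
    (b := ((1 - al) * (1 - ga))%:a) R1 R2); ring.
have W0 : I (2 * x 0 ^+ 2 * y 1 * 2).
  have V : I ((1 + al)%:a * x 2 * (2 * (x 0 * y 3) + (1 - ga)%:a * (x 2 * y 1))
     - (1 - al)%:a * x 3 * (2 * (x 0 * y 2) - (1 + be)%:a * (x 3 * y 1))).
    by apply: (ideal_lin2 idI (a := (1 + al)%:a * x 2)
      (b := - (1 - al)%:a * x 3) A3 A2); ring.
  apply: (ideal_lin4 idI (a := 2 * x 0) (b := 1)
    (c := - ((1 + al) * (1 - ga))%:a) (d := - ((1 - al) * (1 + be))%:a)
    S2 V U2 U3).
  by ring.
apply: I4_ind => //.
  apply: (ideal_cancel idI (c := 2 * 2)); first by rewrite mulf_neq0.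
  by apply: (ideal_lin1 idI (a := 1) W0); ring.
by apply: (ideal_lin1 idI (a := x 1 * y 1) x1); ring.
Qed.

Lemma fin_codim_x I al be ga x y a : chart_ideal I al be ga x y ->
  admissible al be ga -> I (x a) -> fin_codim I.
Proof.
move=> cI nd; move: a; apply: I4_ind => xa.
- exact: fin_codim_x0 cI nd xa.
- exact: fin_codim_x1 cI nd xa.
- exact: fin_codim_x1 (chart_ideal_cyc cI) (admissible_cyc nd) xa.
- exact: fin_codim_x1 (chart_ideal_cyc (chart_ideal_cyc cI))
    (admissible_cyc (admissible_cyc nd)) xa.
Qed.

(** Because the locus where a coordinate vanishes has been dealt with, [x a] may
    be cancelled from any relation. *)
Lemma chart_cancel I al be ga x y a p : chart_ideal I al be ga x y ->
  admissible al be ga -> I (x a * p) ->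
  (forall J, chart_ideal J al be ga x y -> (forall q, I q -> J q) -> J p ->
     fin_codim J) ->
  fin_codim I.
Proof.
move=> cI nd Iap fJ; apply: (chart_split cI Iap) => // J cJ _.
exact: fin_codim_x cJ nd.
Qed.

(** * The points with nonvanishing coordinates *)

Lemma scalar_of_proportional J (z : 'I_4 -> A) :
  ideal J -> (exists i, J (z i - 1)) -> (forall a, exists r, J (z a - r%:a * z 0)) ->
  J 1 \/ forall a, exists c, J (z a - c%:a).
Proof.
move=> idJ [i zi] prop; have [r hr] := prop i.
have [r0|r0] := eqVneq r 0.
  left; apply: (ideal_lin2 idJ (a := 1) (b := -1) hr zi).
  by rewrite r0; ring.
right=> a; have [d hd] := prop a; exists (d / r).
apply: (ideal_cancel idJ r0).
apply: (ideal_lin3 idJ (a := r%:a) (b := - d%:a) (c := d%:a) hd hr zi).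
have -> : d%:a = (d / r)%:a * r%:a by rewrite -rmorphM divfK.
by ring.
Qed.

Lemma fin_codim_proportional J al be ga x y (r e : 'I_4 -> k) :
  chart_ideal J al be ga x y ->
  (forall a, J (x a - (r a)%:a * x 0)) ->
  (forall a, J (x 0 * y a - (e a)%:a * (x a * y 0))) ->
  fin_codim J.
Proof.
move=> cJ hr he; have idJ := chart_ideal_ideal cJ.
have [i xi] := chart_ideal_x cJ.
have [||J1|hx] := scalar_of_proportional (z := x) idJ.
- by exists i.
- by move=> a; exists (r a).
- exact: fin_codim_unit.
have [||J1|hy] := scalar_of_proportional (z := y) idJ.
- exact: chart_ideal_y cJ.
- move=> a; exists (e a * r a).
  (* [x i] is both [1] and [r i] times [x 0], so [x 0] cancels *)
  apply: (ideal_lin4 idJ (a := (r i)%:a) (b := (e a)%:a * (r i)%:a * y 0)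
    (c := y a - (e a * r a)%:a * y 0) (d := - (y a - (e a * r a)%:a * y 0))
    (he a) (hr a) (hr i) xi).
  by ring.
- exact: fin_codim_unit.
exact: (chart_ideal_gen cJ idJ hx hy).
Qed.

(** Here [x d] equals [x 0 / s] or [- x 0 / s] after cancelling [x b] and
    [x c]. *)
Lemma fin_codim_ratio I al be ga x y (b c d : 'I_4) (s : k) :
  chart_ideal I al be ga x y -> admissible al be ga -> s != 0 ->
  I (x b * (x c * (x 0 ^+ 2 - (s ^+ 2)%:a * x d ^+ 2))) ->
  (forall J r, chart_ideal J al be ga x y -> (forall q, I q -> J q) ->
     J (x d - r%:a * x 0) -> fin_codim J) ->
  fin_codim I.
Proof.
move=> cI nd s0 Ip fJ.
have xdE : x d = s^-1%:a * s%:a * x d.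
  by rewrite -rmorphM mulVf // rmorph1 mul1r.
apply: (chart_cancel cI nd Ip) => J cJ sJ Jp.
apply: (chart_cancel cJ nd Jp) => {Jp} K cK sK Kp.
have {Kp} Kp : K ((x 0 - s%:a * x d) * (x 0 + s%:a * x d)).
  by apply: (ideal_lin1 (chart_ideal_ideal cK) (a := 1) Kp); ring.
apply: (chart_split cK Kp) => L cL sL Lp.
  apply: (fJ _ s^-1 cL) => [q Iq|]; first by apply/sL/sK/sJ.
  apply: (ideal_lin1 (chart_ideal_ideal cL) (a := - s^-1%:a) Lp).
  by rewrite {1}xdE; ring.
apply: (fJ _ (- s^-1) cL) => [q Iq|]; first by apply/sL/sK/sJ.
apply: (ideal_lin1 (chart_ideal_ideal cL) (a := s^-1%:a) Lp).
by rewrite {1}xdE; ring.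
Qed.

(** Where x0 is invertible, y_a = e_a x_a y0 / x0.  Substituting this into the difference
    of the first two relations makes it a relation between the x_a alone, up to
    the factor y0. *)
Lemma coordinate_relation I al be ga x y (e : 'I_4 -> k) p :
  chart_ideal I al be ga x y -> 2 != 0 :> k ->
  (forall a, I (x 0 * y a - (e a)%:a * (x a * y 0))) ->
  p * 2 = e 3 - e 2 - al * (e 3 + e 2) ->
  I (y 0 * (x 0 * x 1 - p%:a * (x 2 * x 3))).
Proof.
move=> cI n2 he p2; have idI := chart_ideal_ideal cI.
have /= E1 := chart_ideal_eqs cI 0; have /= E2 := chart_ideal_eqs cI 1.
apply: (ideal_cancel idI n2).
apply: (ideal_lin4 idI (a := x 0) (b := - x 0) (c := (1 - al)%:a * x 2)
  (d := - (1 + al)%:a * x 3) E2 E1 (he 3) (he 2)).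
have -> : 2%:a * (y 0 * (x 0 * x 1 - p%:a * (x 2 * x 3)))
  = y 0 * (2%:a * x 0 * x 1 - (p * 2)%:a * (x 2 * x 3)) by ring.
by rewrite p2; ring.
Qed.

(** If y0 vanishes then so does x0 y_a for every [a], hence x0, because some y_j
    is 1. *)
Lemma chart_cancel_y0 I al be ga x y (e : 'I_4 -> k) p :
  chart_ideal I al be ga x y -> admissible al be ga ->
  (forall a, I (x 0 * y a - (e a)%:a * (x a * y 0))) -> I (y 0 * p) ->
  (forall J, chart_ideal J al be ga x y -> (forall q, I q -> J q) -> J p ->
     fin_codim J) ->
  fin_codim I.
Proof.
move=> cI nd he Ip fJ; apply: (chart_split cI Ip) => // J cJ sJ y0.
apply: (fin_codim_x0 cJ nd); have [j yj] := chart_ideal_y cJ.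
apply: (ideal_lin3 (chart_ideal_ideal cJ) (a := 1) (b := (e j)%:a * x j)
  (c := - x 0) (sJ _ (he j)) y0 yj).
by ring.
Qed.

(** The three coordinate relations x0 x1 = p x2 x3, x0 x2 = q x3 x1,
    x0 x3 = r x1 x2 give x0 ^ 2 = p q x3 ^ 2 and so on, so that x is
    proportional to a vector of scalars because p q, q r, r p are squares. *)
Lemma fin_codim_orbit I al be ga x y (e : 'I_4 -> k) p q r s1 s2 s3 :
  chart_ideal I al be ga x y -> admissible al be ga ->
  (forall a, I (x 0 * y a - (e a)%:a * (x a * y 0))) ->
  p * 2 = e 3 - e 2 - al * (e 3 + e 2) ->
  q * 2 = e 1 - e 3 - be * (e 1 + e 3) ->
  r * 2 = e 2 - e 1 - ga * (e 2 + e 1) ->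
  s1 ^+ 2 = q * r -> s2 ^+ 2 = r * p -> s3 ^+ 2 = p * q ->
  s1 != 0 -> s2 != 0 -> s3 != 0 -> fin_codim I.
Proof.
move=> cI nd he p2 q2 r2 s1E s2E s3E s10 s20 s30.
have [n2 _ _ _ _] := nd; have cI' := chart_ideal_cyc cI.
have P := coordinate_relation cI n2 he p2.
have Q := coordinate_relation (e := e \o cyc) cI' n2 (fun a => he (cyc a)) q2.
have R := coordinate_relation (e := e \o cyc \o cyc) (chart_ideal_cyc cI') n2
  (fun a => he (cyc (cyc a))) r2.
rewrite /= in Q R.
apply: (chart_cancel_y0 cI nd he P) => J1 cJ1 sJ1 {}P.
have {}he a := sJ1 _ (he a).
apply: (chart_cancel_y0 cJ1 nd he (sJ1 _ Q)) => J2 cJ2 sJ2 {}Q.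
have {}he a := sJ2 _ (he a).
apply: (chart_cancel_y0 cJ2 nd he (sJ2 _ (sJ1 _ R))) => J cJ sJ {}R.
have {}he a := sJ _ (he a); move: P Q => /sJ2/sJ P /sJ Q.
have idJ := chart_ideal_ideal cJ.
apply: (fin_codim_ratio (b := 1) (c := 2) (d := 3) cJ nd s30).
  apply: (ideal_lin2 idJ (a := x 0 * x 2) (b := p%:a * x 2 * x 3) P Q).
  by rewrite s3E; ring.
move=> K3 r3 cK3 sK3 X3.
apply: (fin_codim_ratio (b := 2) (c := 3) (d := 1) cK3 nd s10).
  apply/sK3/(ideal_lin2 idJ (a := x 0 * x 3) (b := q%:a * x 3 * x 1) Q R).
  by rewrite s1E; ring.
move=> K1 r1 cK1 sK1 X1.
apply: (fin_codim_ratio (b := 3) (c := 1) (d := 2) cK1 nd s20).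
  apply/sK1/sK3/(ideal_lin2 idJ (a := x 0 * x 1) (b := r%:a * x 1 * x 2) R P).
  by rewrite s2E; ring.
move=> K2 r4 cK2 sK2 X2.
apply: (fin_codim_proportional (r := fun a => [:: 1; r1; r4; r3]`_a) cK2 _
  (fun a => sK2 _ (sK1 _ (sK3 _ (he a))))).
apply: I4_ind => /=.
- by rewrite rmorph1 mul1r subrr; case: (chart_ideal_ideal cK2).
- exact: sK2.
- exact: X2.
- exact/sK2/sK1.
Qed.

Section Roots.
Variables (i a b c al be ga : k).
Hypotheses (i2 : i ^+ 2 = -1) (a2 : a ^+ 2 = al) (b2 : b ^+ 2 = be)
  (c2 : c ^+ 2 = ga).

Definition is_sign (e : k) : Prop := e = 1 \/ e = -1.

(** The sign vector is (1, e, d, - e d).  Up to sign, the numbers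
    p, q, r of [fin_codim_orbit] are al, be, ga, or one of these together with 1
    twice; the square roots of -1, al, be and ga provide the roots of their
    products. *)
Lemma fin_codim_signs I x y e d :
  chart_ideal I al be ga x y -> admissible al be ga ->
  is_sign e -> is_sign d ->
  I (x 0 * y 1 - e%:a * (x 1 * y 0)) ->
  I (x 0 * y 2 - d%:a * (x 2 * y 0)) ->
  I (x 0 * y 3 + (e * d)%:a * (x 3 * y 0)) -> fin_codim I.
Proof.
move=> cI nd se sd h1 h2 h3.
have he l : I (x 0 * y l - ([:: 1; e; d; - (e * d)]`_l)%:a * (x l * y 0)).
  move: l; apply: I4_ind => //=.
    by rewrite rmorph1 mul1r subrr; case: (chart_ideal_ideal cI).
  by rewrite rmorphN mulNr opprK.
have [_ al0 be0 ga0 _] := nd.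
have nz (z w : k) : z ^+ 2 = w -> w != 0 -> z != 0.
  by move=> <-; rewrite sqrf_eq0.
have i0 : i != 0 by apply: nz i2 _; rewrite oppr_eq0 oner_eq0.
have a0 := nz _ _ a2 al0; have b0 := nz _ _ b2 be0; have c0 := nz _ _ c2 ga0.
case: se sd he => -> [->|->] he.
- apply: (fin_codim_orbit (p := -1) (q := 1) (r := - ga) (s1 := i * c)
    (s2 := c) (s3 := i) cI nd he); rewrite ?mulf_neq0 //=; try ring.
  + by rewrite exprMn i2 c2; ring.
  + by rewrite c2; ring.
  + by rewrite i2; ring.
- apply: (fin_codim_orbit (p := 1) (q := - be) (r := -1) (s1 := b)
    (s2 := i) (s3 := i * b) cI nd he); rewrite ?mulf_neq0 //=; try ring.
  + by rewrite b2; ring.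
  + by rewrite i2; ring.
  + by rewrite exprMn i2 b2; ring.
- apply: (fin_codim_orbit (p := - al) (q := -1) (r := 1) (s1 := i)
    (s2 := i * a) (s3 := a) cI nd he); rewrite ?mulf_neq0 //=; try ring.
  + by rewrite i2; ring.
  + by rewrite exprMn i2 a2; ring.
  + by rewrite a2; ring.
- apply: (fin_codim_orbit (p := al) (q := be) (r := ga) (s1 := b * c)
    (s2 := c * a) (s3 := a * b) cI nd he); rewrite ?mulf_neq0 //=; try ring.
  + by rewrite exprMn b2 c2; ring.
  + by rewrite exprMn c2 a2; ring.
  + by rewrite exprMn a2 b2; ring.
Qed.

(** In terms of t_a = y_a / x_a the hypotheses are t1 = e t0 and t3 = - e t2.
    Then the equations N2 = be D2 and N3 = ga D3 reduce to
    (1 + be) (t2 ^ 2 - t0 ^ 2) = 0 and (1 - ga) (t2 ^ 2 - t0 ^ 2) = 0.  The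
    factors 1 + be and 1 - ga cannot both vanish, as al + be + ga + al be ga
    would then be zero; hence t2 = t0 or t2 = - t0. *)
Lemma fin_codim_pair I x y e :
  chart_ideal I al be ga x y -> admissible al be ga -> is_sign e ->
  I (x 0 * y 1 - e%:a * (x 1 * y 0)) -> I (x 2 * y 3 + e%:a * (x 3 * y 2)) ->
  fin_codim I.
Proof.
move=> cI nd se h1 h2; have idI := chart_ideal_ideal cI.
have ee : e * e = 1 by case: se => ->; ring.
have e0 : e != 0 by case: se => ->; rewrite ?oppr_eq0 oner_eq0.
have [be1|be1] := eqVneq (1 + be) 0; last first.
  have /= E3 := chart_ideal_eqs cI 2; have /= E4 := chart_ideal_eqs cI 3.
  (* (1 + be) (t2 ^ 2 - t0 ^ 2) = 0, cleared of denominators *)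
  have H : I (x 1 * (x 3 * ((x 0 * y 2 - x 2 * y 0) * (x 0 * y 2 + x 2 * y 0)))).
    apply: (ideal_cancel idI (mulf_neq0 e0 be1)).
    apply: (ideal_lin4 idI (a := x 0 * x 2 * (x 0 * y 2 + x 2 * y 0))
      (b := - x 0 * x 2 * (x 0 * y 2 - x 2 * y 0))
      (c := - ((x 0 * y 2 - x 2 * y 0) - be%:a * (x 0 * y 2 + x 2 * y 0))
            * x 3 * x 2)
      (d := ((x 0 * y 2 - x 2 * y 0) + be%:a * (x 0 * y 2 + x 2 * y 0))
            * x 0 * x 1) E3 E4 h1 h2).
    by ring.
  have fd J d : chart_ideal J al be ga x y -> (forall q, I q -> J q) ->
      is_sign d -> J (x 0 * y 2 - d%:a * (x 2 * y 0)) -> fin_codim J.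
    move=> cJ sJ sd hd; apply: (chart_cancel (a := 2)
      (p := x 0 * y 3 + (e * d)%:a * (x 3 * y 0)) cJ nd).
      apply: (ideal_lin2 (chart_ideal_ideal cJ) (a := x 0) (b := - e%:a * x 3)
        (sJ _ h2) hd).
      by ring.
    move=> K cK sK h3.
    exact: (fin_codim_signs cK nd se sd (sK _ (sJ _ h1)) (sK _ hd) h3).
  apply: (chart_cancel cI nd H) => J1 cJ1 sJ1 {}H.
  apply: (chart_cancel cJ1 nd H) => J2 cJ2 sJ2 {}H.
  apply: (chart_split cJ2 H) => J cJ sJ hJ.
    apply: (fd J 1) => // [q /sJ1/sJ2/sJ //||]; first by left.
    by rewrite rmorph1 mul1r.
  apply: (fd J (-1)) => // [q /sJ1/sJ2/sJ //||]; first by right.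
  by rewrite rmorphN1 mulN1r opprK.
have ga1 : 1 - ga != 0.
  apply/eqP => ga1; case: nd => _ _ _ _ /eqP; apply.
  have -> : be = -1 by apply/eqP; rewrite -addr_eq0 addrC be1.
  have -> : ga = 1 by apply/esym/eqP; rewrite -subr_eq0 ga1.
  by ring.
have /= E5 := chart_ideal_eqs cI 4; have /= E6 := chart_ideal_eqs cI 5.
(* (1 - ga) (t3 ^ 2 - t0 ^ 2) = 0, cleared of denominators *)
have H : I (x 1 * (x 2 * ((x 0 * y 3 - x 3 * y 0) * (x 0 * y 3 + x 3 * y 0)))).
  apply: (ideal_cancel idI (mulf_neq0 e0 ga1)).
  apply: (ideal_lin4 idI (a := - x 0 * x 3 * (x 0 * y 3 + x 3 * y 0))
    (b := x 0 * x 3 * (x 0 * y 3 - x 3 * y 0))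
    (c := - ((x 0 * y 3 - x 3 * y 0) + ga%:a * (x 0 * y 3 + x 3 * y 0))
          * x 2 * x 3)
    (d := e%:a * ((x 0 * y 3 - x 3 * y 0) - ga%:a * (x 0 * y 3 + x 3 * y 0))
          * x 0 * x 1) E5 E6 h1 h2).
  by case: se => ->; ring.
have fd J d : chart_ideal J al be ga x y -> (forall q, I q -> J q) ->
    is_sign d -> J (x 0 * y 3 - d%:a * (x 3 * y 0)) -> fin_codim J.
  move=> cJ sJ sd hd; apply: (chart_cancel (a := 3)
    (p := x 0 * y 2 - (- (e * d))%:a * (x 2 * y 0)) cJ nd).
    apply: (ideal_lin2 (chart_ideal_ideal cJ) (a := e%:a * x 0)
      (b := - e%:a * x 2) (sJ _ h2) hd).
    by case: se => ->; ring.
  move=> K cK sK h3.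
  apply: (fin_codim_signs cK nd se _ (sK _ (sJ _ h1)) h3).
    case: se sd => -> [] ->; rewrite /is_sign ?mulrN1 ?mulN1r ?opprK ?mul1r;
      by [left|right].
  have -> : e * - (e * d) = - d by rewrite mulrN mulrA ee mul1r.
  by rewrite rmorphN mulNr; apply: sK.
apply: (chart_cancel cI nd H) => J1 cJ1 sJ1 {}H.
apply: (chart_cancel cJ1 nd H) => J2 cJ2 sJ2 {}H.
apply: (chart_split cJ2 H) => J cJ sJ hJ.
  apply: (fd J 1) => // [q /sJ1/sJ2/sJ //||]; first by left.
  by rewrite rmorph1 mul1r.
apply: (fd J (-1)) => // [q /sJ1/sJ2/sJ //||]; first by right.
by rewrite rmorphN1 mulN1r opprK.
Qed.

(** When x0 y1 + x1 y0 vanishes so does x2 y3 - x3 y2, by the second relation, and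
    when x2 y3 + x3 y2 vanishes so does x0 y1 - x1 y0, by the first one: these
    are the two signs of [fin_codim_pair]. *)
Lemma fin_codim_quad I x y :
  chart_ideal I al be ga x y -> admissible al be ga ->
  I ((x 2 * y 3 + x 3 * y 2) * (x 0 * y 1 + x 1 * y 0)) -> fin_codim I.
Proof.
move=> cI nd H; apply: (chart_split cI H) => J cJ _ hJ;
  have idJ := chart_ideal_ideal cJ.
- have /= E1 := chart_ideal_eqs cJ 0.
  apply: (fin_codim_pair (e := 1) cJ nd); first by left.
    by apply: (ideal_lin2 idJ (a := 1) (b := al%:a) E1 hJ); ring.
  by rewrite rmorph1 mul1r.
- have /= E2 := chart_ideal_eqs cJ 1.
  apply: (fin_codim_pair (e := -1) cJ nd); first by right.
    by rewrite rmorphN1 mulN1r opprK.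
  by apply: (ideal_lin2 idJ (a := -1) (b := 1) E2 hJ); ring.
Qed.

End Roots.

(** The equation N1 = al D1, cleared of denominators: multiply the two first
    relations crosswise. *)
Lemma quad_relation I al be ga x y : chart_ideal I al be ga x y ->
  I ((x 0 * y 1 - x 1 * y 0) * (x 2 * y 3 - x 3 * y 2)
     - al%:a * ((x 2 * y 3 + x 3 * y 2) * (x 0 * y 1 + x 1 * y 0))).
Proof.
move=> cI.
have /= E1 := chart_ideal_eqs cI 0; have /= E2 := chart_ideal_eqs cI 1.
apply: (ideal_lin2 (chart_ideal_ideal cI) (a := x 0 * y 1 + x 1 * y 0)
  (b := - (x 0 * y 1 - x 1 * y 0)) E1 E2).
by ring.
Qed.

(** The addition law [NN] turns the equations N1 = al D1, N2 = be D2, N3 = ga D3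
    into (al + be + ga + al be ga) D1 D2 D3 = 0. *)
Lemma product_relation I al be ga x y :
  chart_ideal I al be ga x y -> admissible al be ga ->
  I ((x 2 * y 3 + x 3 * y 2) * (x 0 * y 1 + x 1 * y 0) *
     ((x 3 * y 1 + x 1 * y 3) * (x 0 * y 2 + x 2 * y 0) *
      ((x 1 * y 2 + x 2 * y 1) * (x 0 * y 3 + x 3 * y 0)))).
Proof.
move=> cI [_ _ _ _ s0]; have idI := chart_ideal_ideal cI.
have cI' := chart_ideal_cyc cI.
have G1 := quad_relation cI; have /= G2 := quad_relation cI'.
have /= G3 := quad_relation (chart_ideal_cyc cI').
apply: (ideal_cancel idI s0).
set D1 := (x 2 * y 3 + x 3 * y 2) * _ in G1 *.
set D2 := (x 3 * y 1 + x 1 * y 3) * _ in G2 *.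
set D3 := (x 1 * y 2 + x 2 * y 1) * _ in G3 *.
set N1 := _ * _ in G1; set N2 := _ * _ in G2; set N3 := _ * _ in G3.
have NN : N1 * D2 * D3 + D1 * N2 * D3 + D1 * D2 * N3 + N1 * N2 * N3 = 0.
  by rewrite /N1 /N2 /N3 /D1 /D2 /D3; ring.
apply: (ideal_lin3 idI (a := - (D2 * D3 + N2 * N3))
  (b := - (D1 * D3 + al%:a * D1 * N3))
  (c := - (D1 * D2 + al%:a * be%:a * D1 * D2)) G1 G2 G3).
apply/eqP; rewrite -subr_eq0 -[X in _ == X]NN; apply/eqP.
by ring.
Qed.

Lemma fin_codim_chart I x y (i a b c : k) al be ga :
  i ^+ 2 = -1 -> a ^+ 2 = al -> b ^+ 2 = be -> c ^+ 2 = ga ->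
  chart_ideal I al be ga x y -> admissible al be ga -> fin_codim I.
Proof.
move=> i2 a2 b2 c2 cI nd.
apply: (chart_split cI (product_relation cI nd)) => [J cJ _|J cJ _ H].
  exact: (fin_codim_quad i2 a2 b2 c2 cJ nd).
have nd' := admissible_cyc nd.
apply: (chart_split cJ H) => K cK _.
  exact: (fin_codim_quad i2 b2 c2 a2 (chart_ideal_cyc cK) nd').
exact: (fin_codim_quad i2 c2 a2 b2 (chart_ideal_cyc (chart_ideal_cyc cK))
  (admissible_cyc nd')).
Qed.

End Charts.

(** * The charts of Gamma *)

Section Polynomials.
Variable k : fieldType.
Local Notation S := {mpoly k[4 + 4]}.
Implicit Types (al be ga : k).
#[local] Arguments GRing.in_alg : simpl never.

Lemma in_ideal_ideal (A : comAlgType k) (E : A -> Prop) : ideal (in_ideal E).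
Proof.
split.
- by exists [::] => [u|]; rewrite ?big_nil ?in_nil.
- move=> p q [s sE ->] [t tE ->]; exists (s ++ t); last by rewrite big_cat.
  by move=> u; rewrite mem_cat => /orP[/sE|/tE].
- move=> a p [s sE ->]; exists [seq (a * u.1, u.2) | u <- s].
    by move=> _ /mapP[u us ->]; exact: (sE u us).
  by rewrite mulr_sumr big_map; apply: eq_bigr => u _; rewrite mulrA.
Qed.

Lemma in_ideal_mem (A : comAlgType k) (E : A -> Prop) g : E g -> in_ideal E g.
Proof.
move=> Eg; exists [:: (1, g)]; last by rewrite big_seq1 mul1r.
by move=> u; rewrite inE => /eqP ->.
Qed.

Lemma mpoly_scalar n (J : {mpoly k[n]} -> Prop) : ideal J ->
  (forall i, exists c, J ('X_i - in_alg _ c)) ->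
  forall p, exists c, J (p - in_alg _ c).
Proof.
move=> idJ hX p.
pose scal (q : {mpoly k[n]}) := exists c, J (q - in_alg _ c).
have [J0 _ _] := idJ.
have scalM u v : scal u -> scal v -> scal (u * v).
  move=> [c uc] [d vd]; exists (c * d).
  by apply: (ideal_lin2 idJ (a := v) (b := in_alg _ c) uc vd); ring.
have scal1 : scal 1 by exists 1; rewrite rmorph1 subrr.
rewrite (mpolyE p); apply: (big_ind scal).
- by exists 0; rewrite rmorph0 subrr.
- move=> u v [c uc] [d vd]; exists (c + d).
  by apply: (ideal_lin2 idJ (a := 1) (b := 1) uc vd); ring.
move=> m _; rewrite -mulr_algl; apply: (scalM).
  by exists p@_m; rewrite in_algE subrr.
rewrite mpolyXE_id; apply: (big_ind scal) => // i _.
by elim: (m i) => [|d IH]; rewrite ?expr0 // exprS; apply: (scalM) => //; apply: hX.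
Qed.

Lemma fin_codim_mpoly (J : S -> Prop) : ideal J ->
  (forall i, exists c, J (X k i - in_alg _ c)) ->
  (forall j, exists c, J (Y k j - in_alg _ c)) -> fin_codim J.
Proof.
move=> idJ hx hy; exists [:: 1] => p.
have [|c hc] := mpoly_scalar idJ _ p.
  by move=> i; rewrite -[i]splitK; case: (split i).
by exists (fun=> c); rewrite big_ord1.
Qed.

Lemma form11D (r s : 'M[k]_4) : form11 (r + s) = form11 r + form11 s.
Proof.
rewrite /form11 -big_split; apply: eq_bigr => a _.
by rewrite -big_split; apply: eq_bigr => b _; rewrite mxE scalerDl.
Qed.

Lemma form11Z c (r : 'M[k]_4) : form11 (c *: r) = c *: form11 r.
Proof.
rewrite /form11 scaler_sumr; apply: eq_bigr => a _.
by rewrite scaler_sumr; apply: eq_bigr => b _; rewrite mxE scalerA.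
Qed.

Lemma form11_0 : form11 (0 : 'M[k]_4) = 0.
Proof. by rewrite -(scale0r 0) form11Z scale0r. Qed.

Lemma form11N (r : 'M[k]_4) : form11 (- r) = - form11 r.
Proof. by rewrite -scaleN1r form11Z scaleN1r. Qed.

Lemma form11_tens (a b : 'I_4) : form11 (tens (x k a) (x k b)) = X k a * Y k b.
Proof.
rewrite /tens /x trmx_delta mul_delta_mx /form11 (bigD1 a) //= (bigD1 b) //=.
rewrite mxE !eqxx scale1r !big1 ?addr0 // => [a' a'a|b' b'b].
  by rewrite big1 // => b' _; rewrite mxE (negPf a'a) scale0r.
by rewrite mxE eqxx (negPf b'b) scale0r.
Qed.

Lemma form11_relations al be ga n :
  form11 (relations al be ga)`_n =
  (gamma_eqs (in_alg S al) (in_alg S be) (in_alg S ga) (@X k) (@Y k))`_n.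
Proof.
case: n => [|[|[|[|[|[|n]]]]]]; last by rewrite !nth_default // form11_0.
all: rewrite /relations /gamma_eqs; cbn [nth].
all: rewrite ?(form11D, form11N, form11Z) !form11_tens ?(in_algE, mulr_algl).
all: by do ?[congr (_ - _) | congr (_ + _) | congr (_ *: _)].
Qed.

Lemma chart_ideal_Gamma al be ga i j :
  chart_ideal (in_ideal (chart_eqs (R al be ga) i j)) al be ga (@X k) (@Y k).
Proof.
split.
- exact: in_ideal_ideal.
- by exists i; apply: in_ideal_mem; right; left.
- by exists j; apply: in_ideal_mem; right; right.
- move=> n; rewrite -form11_relations; apply: in_ideal_mem; left.
  eexists => //; have [n6|n6] := ltnP n (size (relations al be ga)).
    by rewrite memv_span ?mem_nth.
  by rewrite nth_default // mem0v.
- exact: fin_codim_mpoly.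
Qed.

Lemma finite_zero_locus_of_admissible (i a b c : k) al be ga :
  i ^+ 2 = -1 -> a ^+ 2 = al -> b ^+ 2 = be -> c ^+ 2 = ga ->
  admissible al be ga -> finite_zero_locus (R al be ga).
Proof.
move=> i2 a2 b2 c2 nd l m.
exact: fin_codim_chart i2 a2 b2 c2 (chart_ideal_Gamma al be ga l m) nd.
Qed.

End Polynomials.

(** * Points of Gamma over extensions of the base field *)

Section Curves.
Variable k : fieldType.
Implicit Types (al be ga : k).

(** The n + 1 powers p ^ 0, ..., p ^ n have coordinates in a space of dimension n
    modulo the ideal, so they satisfy a linear relation, which [phi] maps to an
    algebraic equation for [phi p]. *)
Lemma algebraic_of_fin_codim (A : comAlgType k) (E : A -> Prop)
    (L : fieldType) (iota : {rmorphism k -> L}) (phi : {rmorphism A -> L}) :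
  (forall c p, phi (c *: p) = iota c * phi p) -> (forall e, E e -> phi e = 0) ->
  finite_dim_quotient E -> forall p, algebraicOver iota (phi p).
Proof.
move=> phiZ phiE [s hs] p; set n := size s in hs.
have [c hc] := fin_all_exists (fun i : 'I_n.+1 => hs (p ^+ i)).
pose C := \matrix_(i < n.+1, l < n) c i l.
have /rowV0Pn[u /sub_kermxP uC u0] : kermx C != 0.
  by rewrite -mxrank_eq0 mxrank_ker -lt0n subn_gt0 ltnS rank_leq_col.
have phi_ideal q : in_ideal E q -> phi q = 0.
  case=> t tE ->; rewrite rmorph_sum big1_seq // => v /andP[_ vt].
  by rewrite rmorphM (phiE _ (tE v vt)) mulr0.
have phiX (i : 'I_n.+1) : phi p ^+ i = \sum_(l < n) iota (C i l) * phi s`_l.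
  apply/eqP; rewrite -subr_eq0 -[X in _ == X](phi_ideal _ (hc i)) rmorphB rmorphXn.
  rewrite rmorph_sum; apply/eqP; congr (_ - _); apply: eq_bigr => l _.
  by rewrite phiZ mxE.
exists (rVpoly u).
  by apply: contraNneq u0 => P0; rewrite -(rVpolyK u) P0 linear0.
rewrite /root (horner_coef_wide (n := n.+1)); last first.
  by rewrite size_map_poly size_poly.
under eq_bigr => i _ do rewrite coef_map coef_rVpoly_ord phiX mulr_sumr.
rewrite exchange_big big1 // => l _.
have := congr1 (fun v : 'rV_n => iota (v 0 l)) uC.
rewrite !mxE rmorph0 rmorph_sum /= => ul.
rewrite -[RHS](mul0r (phi s`_l)) -[X in _ = X * _]ul mulr_suml.
by apply: eq_bigr => i _; rewrite mulrA rmorphM.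
Qed.

Lemma algebraicOver_comp (F L : fieldType) (iota : {rmorphism k -> F})
    (j : {rmorphism F -> L}) (t : F) :
  algebraicOver (j \o iota) (j t) -> algebraicOver iota t.
Proof.
by case=> P P0 rt; exists P => //; rewrite map_poly_comp fmorph_root in rt.
Qed.

Lemma polyX_transcendental :
  ~ algebraicOver (@tofrac {poly k} \o polyC) (tofrac 'X).
Proof.
case=> P P0; rewrite map_poly_comp /root horner_map /= -/(P \Po 'X) comp_polyXr.
by rewrite tofrac_eq0 (negPf P0).
Qed.

(** The monomial (x a / x i) (y b / y j) is a regular function on the chart
    (i, j); using a product of two coordinates allows the parameter t1 / t0 of
    the curve to be read off directly. *)
Definition transcendental_point (L : fieldType) (iota : {rmorphism k -> L})
    al be ga (x y : 'I_4 -> L) : Prop :=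
  (forall n, (gamma_eqs (iota al) (iota be) (iota ga) x y)`_n = 0) /\
  exists i j a b, [/\ x i != 0, y j != 0 &
    ~ algebraicOver iota (x a / x i * (y b / y j))].

Lemma transcendental_point_cyc (L : fieldType) (iota : {rmorphism k -> L})
    al be ga (x y : 'I_4 -> L) :
  transcendental_point iota al be ga x y ->
  transcendental_point iota be ga al (x \o cyc) (y \o cyc).
Proof.
case=> eqs [i [j [a [b h]]]]; split.
  case=> [|[|[|[|[|[|n]]]]]]; last by rewrite nth_default.
  - exact: (eqs 2).
  - exact: (eqs 3).
  - exact: (eqs 4).
  - exact: (eqs 5).
  - exact: (eqs 0).
  - exact: (eqs 1).
exists (cyc (cyc i)), (cyc (cyc j)).
by exists (cyc (cyc a)), (cyc (cyc b)); rewrite /= !cyc3.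
Qed.

Lemma gamma_eqs_morph (B C : comNzRingType) (f : {rmorphism B -> C}) a b c x y n :
  f (gamma_eqs a b c x y)`_n = (gamma_eqs (f a) (f b) (f c) (f \o x) (f \o y))`_n.
Proof.
case: n => [|[|[|[|[|[|n]]]]]]; last by rewrite !nth_default ?rmorph0.
all: by rewrite /= !(rmorphB, rmorphD, rmorphM).
Qed.

Lemma gamma_eqs_scale (B : comNzRingType) (a b c u v : B) x y n :
  (gamma_eqs a b c (fun l => x l * u) (fun l => y l * v))`_n
  = (gamma_eqs a b c x y)`_n * (u * v).
Proof.
case: n => [|[|[|[|[|[|n]]]]]]; last by rewrite !nth_default ?mul0r.
all: rewrite /=; ring.
Qed.

(** A point of the chart (i, j) over [L] is a morphism from its coordinate ring to
    [L], and this ring is finite-dimensional when Gamma is finite. *)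
Lemma not_finite_of_transcendental (L : fieldType) (iota : {rmorphism k -> L})
    al be ga (x y : 'I_4 -> L) :
  transcendental_point iota al be ga x y -> ~ finite_zero_locus (R al be ga).
Proof.
case=> eqs [i [j [a [b [xi yj tr]]]]] fin; apply: tr.
pose h (l : 'I_(4 + 4)) :=
  match split l with inl a => x a / x i | inr b => y b / y j end.
pose phi : {rmorphism {mpoly k[4 + 4]} -> L} := mmap iota h.
have phiX l : phi (X k l) = x l / x i.
  by rewrite /phi /X /= mmapX mmap1U /h (unsplitK (inl l)).
have phiY l : phi (Y k l) = y l / y j.
  by rewrite /phi /Y /= mmapX mmap1U /h (unsplitK (inr l)).
have phiZ c p : phi (c *: p) = iota c * phi p by rewrite /phi /= mmapZ.
rewrite -phiX -phiY -rmorphM.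
apply: (algebraic_of_fin_codim phiZ _ (fin i j)) => e.
have phiC c : phi (in_alg _ c) = iota c by rewrite in_algE phiZ rmorph1 mulr1.
case=> [[r rR ->]|[->|->]]; last 2 first.
- by rewrite rmorphB rmorph1 phiX divff // subrr.
- by rewrite rmorphB rmorph1 phiY divff // subrr.
rewrite (coord_span (X := in_tuple (relations al be ga)) rR).
rewrite (big_morph (@form11 k) (@form11D k) (form11_0 k)) rmorph_sum big1 // => n _.
rewrite form11Z phiZ form11_relations gamma_eqs_morph !phiC.
have -> : (gamma_eqs (iota al) (iota be) (iota ga) (phi \o X k) (phi \o Y k))`_n
  = (gamma_eqs (iota al) (iota be) (iota ga) (fun l => x l / x i)
       (fun l => y l / y j))`_n.
  by rewrite /gamma_eqs /= !phiX !phiY.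
by rewrite gamma_eqs_scale eqs mul0r mulr0.
Qed.

(** Stated towards a contradiction, because whether [d] already has a square root
    in [F] need not be decidable. *)
Lemma sqrt_extension (F : fieldType) (d : F) :
  (forall (L : fieldType) (j : {rmorphism F -> L}) s, s ^+ 2 = j d -> False) ->
  False.
Proof.
move=> H.
have irr : irreducible_poly ('X^2 - d%:P).
  apply: cubic_irreducible; first by rewrite size_XnsubC.
  move=> s; apply/negP; rewrite /root !hornerE subr_eq0 => /eqP sd.
  exact: (H F idfun s).
have [L _ [z rz _]] := irredp_FAdjoin irr.
apply: (H L (in_alg L) z); apply/eqP; rewrite -subr_eq0.
by move: rz; rewrite /root rmorphB /= map_polyXn map_polyC !hornerE.
Qed.

Lemma common_ratio (F : fieldType) (u v w z : F) :
  u * z = v * w -> (u != 0) || (v != 0) -> exists2 q, q * u = w & q * v = z.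
Proof.
move=> uzvw; have [u0 /= v0|u0 _] := eqVneq u 0; last first.
  exists (w / u); first by rewrite divfK.
  by rewrite mulrAC [w * v]mulrC -uzvw mulrC mulKf.
exists (z / v); last by rewrite divfK.
by move/eqP: uzvw; rewrite u0 mul0r mulr0 eq_sym mulf_eq0 (negPf v0) => /eqP.
Qed.

(** Given t_a = y_a / x_a with t0 = 1 and t1 = [t], the equations say that
    x0 x1 = p x2 x3, x0 x2 = q x3 x1, x0 x3 = r x1 x2.  With square roots P, Q, R
    of p, q, r this is solved by x = (P Q R, P, Q, R). *)
Lemma square_root_point (F : fieldType) (iota : {rmorphism k -> F})
    al be ga (t y2 y3 p q r : F) :
  ~ algebraicOver iota t -> t != 0 -> p != 0 -> q != 0 -> r != 0 ->
  p * (t - 1) = iota al * (y3 + y2) -> p * (t + 1) = y3 - y2 ->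
  q * (y2 - 1) = iota be * (t + y3) -> q * (y2 + 1) = t - y3 ->
  r * (y3 - 1) = iota ga * (t + y2) -> r * (y3 + 1) = y2 - t ->
  (forall (L : fieldType) (iota' : {rmorphism k -> L}) x y,
     transcendental_point iota' al be ga x y -> False) -> False.
Proof.
move=> tr t0 p0 q0 r0 p1 p2 q1 q2 r1 r2 H.
apply: (sqrt_extension (d := p)) => L1 j1 P Pp.
apply: (sqrt_extension (d := j1 q)) => L2 j2 Q Qq.
apply: (sqrt_extension (d := j2 (j1 r))) => L j3 R Rr.
pose j : {rmorphism F -> L} := j3 \o j2 \o j1.
have {}Pp : j3 (j2 P) ^+ 2 = j p by rewrite -!rmorphXn Pp.
have {}Qq : j3 Q ^+ 2 = j q by rewrite -rmorphXn Qq.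
have {}Rr : R ^+ 2 = j r by [].
move: (j3 (j2 P)) (j3 Q) Pp Qq => {}P {}Q Pp Qq.
have sq_neq0 (u v : L) : u ^+ 2 = v -> v != 0 -> u != 0.
  by move=> <-; rewrite sqrf_eq0.
have P0 : P != 0 by apply: (sq_neq0 _ _ Pp); rewrite fmorph_eq0.
have Q0 : Q != 0 by apply: (sq_neq0 _ _ Qq); rewrite fmorph_eq0.
have R0 : R != 0 by apply: (sq_neq0 _ _ Rr); rewrite fmorph_eq0.
apply: (H L (j \o iota) (fun l => [:: P * Q * R; P; Q; R]`_l)
  (fun l => [:: P * Q * R; P * j t; Q * j y2; R * j y3]`_l)).
split; last first.
  exists 1, 0, 0, 1; rewrite /= !mulf_neq0 //; split=> //.
  have -> : P * Q * R / P * (P * j t / (P * Q * R)) = j t by field; rewrite P0 Q0 R0.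
  by move/algebraicOver_comp.
have lin (u v : F) : u = v -> j u - j v = 0 by move=> ->; rewrite subrr.
case=> [|[|[|[|[|[|n]]]]]] /=; last by rewrite nth_default.
- transitivity (Q * R * (j (p * (t - 1)) - j (iota al * (y3 + y2)))).
    by rewrite !rmorphM -Pp; ring.
  by rewrite lin // mulr0.
- transitivity (Q * R * (j (p * (t + 1)) - j (y3 - y2))).
    by rewrite !rmorphM -Pp; ring.
  by rewrite lin // mulr0.
- transitivity (R * P * (j (q * (y2 - 1)) - j (iota be * (t + y3)))).
    by rewrite !rmorphM -Qq; ring.
  by rewrite lin // mulr0.
- transitivity (R * P * (j (q * (y2 + 1)) - j (t - y3))).
    by rewrite !rmorphM -Qq; ring.
  by rewrite lin // mulr0.
- transitivity (P * Q * (j (r * (y3 - 1)) - j (iota ga * (t + y2)))).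
    by rewrite !rmorphM -Rr; ring.
  by rewrite lin // mulr0.
- transitivity (P * Q * (j (r * (y3 + 1)) - j (y2 - t))).
    by rewrite !rmorphM -Rr; ring.
  by rewrite lin // mulr0.
Qed.

(** Put t0 = 1 and t1 = [t].  The equation N1 = al D1 is linear in (t2, t3), and
    its solutions are the multiples [lam] (m, n).  The equations N2 = be D2 and
    N3 = ga D3 then become
      (1 + be) (m n lam ^ 2 + t) = (1 - be) (1 - al) (t ^ 2 - 1) lam,
      (1 - ga) (m n lam ^ 2 + t) = (1 + ga) (1 + al) (t ^ 2 - 1) lam,
    and both follow from one quadratic equation for [lam], with [ka] the common
    ratio of their coefficients. *)
Lemma quadratic_point (F : fieldType) (iota : {rmorphism k -> F})
    al be ga ka (t lam : F) :
  2 != 0 :> k -> al != 0 -> be != 0 -> ga != 0 ->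
  ka * (1 + be) = (1 - be) * (1 - al) -> ka * (1 - ga) = (1 + ga) * (1 + al) ->
  ~ algebraicOver iota t -> t != 0 -> t + 1 != 0 ->
  let m := (1 - iota al) * t - (1 + iota al) in
  let n := (1 + iota al) * t - (1 - iota al) in
  m * n * lam ^+ 2 - iota ka * (t ^+ 2 - 1) * lam + t = 0 ->
  (forall (L : fieldType) (iota' : {rmorphism k -> L}) x y,
     transcendental_point iota' al be ga x y -> False) -> False.
Proof.
move=> n2 al0 be0 ga0 kabe kaga tr t0 t1 m n quad.
have n2' : 2 != 0 :> F by rewrite -(rmorph_nat iota) fmorph_eq0.
have lam0 : lam != 0.
  apply: contraNneq t0 => l0; rewrite -quad l0.
  by apply/eqP; ring.
have unequal (u : F) : (u - 1 != 0) || (u + 1 != 0).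
  rewrite -negb_and; apply: contraNN n2' => /andP[/eqP a1 /eqP a2].
  have -> : 2 = (u + 1) - (u - 1) by ring.
  by rewrite a1 a2 subr0.
have nz (e : k) (u v : F) : e != 0 -> u + v != 0 ->
    forall q w w', q * w = iota e * u -> q * w' = v -> q != 0.
  move=> e0 uv q w w' qw qw'; apply: contraNneq uv => q0.
  move: qw' qw; rewrite q0 !mul0r => <- /eqP; rewrite eq_sym addr0.
  by rewrite mulf_eq0 fmorph_eq0 (negPf e0).
have kabe' := congr1 iota kabe; have kaga' := congr1 iota kaga.
rewrite !(rmorphM, rmorphB, rmorphD, rmorph1) in kabe' kaga'.
have [q q1 q2] : exists2 q, q * (lam * m - 1) = iota be * (t + lam * n) &
    q * (lam * m + 1) = t - lam * n.
  apply: common_ratio => //; apply/eqP; rewrite -subr_eq0; apply/eqP.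
  transitivity (- (1 + iota be) * (m * n * lam ^+ 2 + t)
     + (1 - iota be) * (1 - iota al) * (t ^+ 2 - 1) * lam).
    by rewrite /m /n; ring.
  rewrite -kabe'.
  transitivity (- (1 + iota be) *
    (m * n * lam ^+ 2 - iota ka * (t ^+ 2 - 1) * lam + t)); first by ring.
  by rewrite quad mulr0.
have [r r1 r2] : exists2 r, r * (lam * n - 1) = iota ga * (t + lam * m) &
    r * (lam * n + 1) = lam * m - t.
  apply: common_ratio => //; apply/eqP; rewrite -subr_eq0; apply/eqP.
  transitivity ((1 - iota ga) * (m * n * lam ^+ 2 + t)
     - (1 + iota ga) * (1 + iota al) * (t ^+ 2 - 1) * lam).
    by rewrite /m /n; ring.
  rewrite -kaga'.
  transitivity ((1 - iota ga) *
    (m * n * lam ^+ 2 - iota ka * (t ^+ 2 - 1) * lam + t)); first by ring.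
  by rewrite quad mulr0.
have q0 : q != 0.
  apply: (nz _ _ _ be0 _ _ _ _ q1 q2).
  by rewrite (_ : _ + _ = 2 * t) ?mulf_neq0 //; ring.
have r0 : r != 0.
  apply: (nz ga _ (t - lam * m) ga0 _ r _ (- (lam * n + 1)) r1).
    by rewrite (_ : _ + _ = 2 * t) ?mulf_neq0 //; ring.
  by rewrite mulrN r2 opprB.
have p0 : 2 * iota al * lam != 0 by rewrite !mulf_neq0 ?fmorph_eq0.
apply: (square_root_point tr t0 p0 q0 r0 _ _ q1 q2 r1 r2).
  by rewrite /m /n; ring.
by rewrite /m /n; ring.
Qed.

(** That al + be + ga + al be ga vanishes means that the two equations for [lam]
    in [quadratic_point] are proportional.  The last hypothesis, that one of
    them is nontrivial on the left-hand side, keeps the quadratic equation from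
    degenerating to lam = 0. *)
Lemma curve_point (K : fieldType) (iota : {rmorphism k -> K}) (t : K) al be ga :
  ~ algebraicOver iota t -> 2 != 0 :> k -> al != 0 -> be != 0 -> ga != 0 ->
  al + be + ga + al * be * ga = 0 -> (1 + be != 0) || (1 - ga != 0) ->
  (forall (L : fieldType) (iota' : {rmorphism k -> L}) x y,
     transcendental_point iota' al be ga x y -> False) -> False.
Proof.
move=> tr n2 al0 be0 ga0 s0 bega H.
have [ka ka1 ka2] : exists2 ka,
    ka * (1 + be) = (1 - be) * (1 - al) & ka * (1 - ga) = (1 + ga) * (1 + al).
  apply: common_ratio => //; apply/eqP; rewrite -subr_eq0; apply/eqP.
  transitivity (2 * (al + be + ga + al * be * ga)); first by ring.
  by rewrite s0 mulr0.
have lin_neq0 a b : (a != 0) || (b != 0) -> iota a * t + iota b != 0.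
  move=> ab; apply/negP => /eqP tab; apply: tr; exists (a *: 'X + b%:P).
    apply: contraTneq ab => P0; rewrite negb_or !negbK.
    have /(congr1 (fun P : {poly k} => P`_1)) := P0.
    have /(congr1 (fun P : {poly k} => P`_0)) := P0.
    by rewrite !coefE /= !(mulr0, mulr1, add0r, addr0) => -> ->; rewrite !eqxx.
  by rewrite /root rmorphD /= map_polyZ map_polyX map_polyC !hornerE tab.
have t0 : t != 0.
  by have := lin_neq0 1 0; rewrite rmorph1 rmorph0 mul1r addr0 oner_eq0; apply.
have t1 : t + 1 != 0.
  by have := lin_neq0 1 1; rewrite rmorph1 mul1r oner_eq0; apply.
have sum2 : (1 - al != 0) || (1 + al != 0).
  rewrite -negb_and; apply: contraNN n2 => /andP[/eqP a1 /eqP a2].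
  have -> : 2 = 1 - al + (1 + al) :> k by ring.
  by rewrite a1 a2 addr0.
pose m := (1 - iota al) * t - (1 + iota al).
pose n := (1 + iota al) * t - (1 - iota al).
have m0 : m != 0.
  have := lin_neq0 (1 - al) (- (1 + al)).
  by rewrite rmorphN rmorphB rmorphD rmorph1 oppr_eq0; apply.
have n0 : n != 0.
  have := lin_neq0 (1 + al) (- (1 - al)).
  by rewrite rmorphN rmorphB rmorphD rmorph1 oppr_eq0 orbC; apply.
(* the discriminant of the quadratic equation for lam *)
pose d := (iota ka * (t ^+ 2 - 1)) ^+ 2 - 4 * m * n * t.
apply: (sqrt_extension (d := d)) => L j s sd.
have j0 z : z != 0 -> j z != 0 by rewrite fmorph_eq0.
have n2' : 2 != 0 :> L by rewrite -(rmorph_nat (j \o iota)) fmorph_eq0.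
pose lam := (j (iota ka * (t ^+ 2 - 1)) + s) / (2 * j (m * n)).
apply: (quadratic_point (iota := j \o iota) (t := j t) (lam := lam)
  n2 al0 be0 ga0 ka1 ka2 _ (j0 _ t0)) H.
- by move/algebraicOver_comp.
- by rewrite -(rmorph1 j) -rmorphD j0.
have -> : (1 - (j \o iota) al) * j t - (1 + (j \o iota) al) = j m.
  by rewrite /m /= !(rmorphB, rmorphM, rmorphD, rmorph1).
have -> : (1 + (j \o iota) al) * j t - (1 - (j \o iota) al) = j n.
  by rewrite /n /= !(rmorphB, rmorphM, rmorphD, rmorph1).
have -> : (j \o iota) ka * (j t ^+ 2 - 1) = j (iota ka * (t ^+ 2 - 1)).
  by rewrite /= !(rmorphB, rmorphM, rmorphXn, rmorph1).
have den0 : 2 * j (m * n) != 0 by rewrite mulf_neq0 ?j0 ?mulf_neq0.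
(* multiply by 4 m n to complete the square *)
apply: (mulfI (mulf_neq0 n2' den0)); rewrite mulr0.
set u := j (iota ka * _) in lam *.
have lamE : 2 * j (m * n) * lam = u + s by rewrite /lam mulrC divfK.
transitivity ((2 * j (m * n) * lam) ^+ 2 - 2 * u * (2 * j (m * n) * lam)
  + 4 * j m * j n * j t).
  by rewrite !rmorphM; ring.
rewrite lamE; transitivity (s ^+ 2 - (u ^+ 2 - 4 * j m * j n * j t)).
  by ring.
rewrite sd /d rmorphB rmorphXn -/u !rmorphM rmorph_nat.
by ring.
Qed.

(** At a pair (x, x) with x0 = x1 = 0 the first relation reads 2 al x2 x3 = 0 and
    the other ones hold identically. *)
Lemma line_point (K : fieldType) (iota : {rmorphism k -> K}) (t : K) be ga :
  ~ algebraicOver iota t ->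
  transcendental_point iota 0 be ga
    (fun l => [:: 0; 0; 1; t]`_l) (fun l => [:: 0; 0; 1; t]`_l).
Proof.
move=> tr; split; last first.
  by exists 2, 2, 3, 2; rewrite /= oner_eq0 !divr1 mulr1.
case=> [|[|[|[|[|[|n]]]]]] /=; last by rewrite nth_default.
all: by rewrite ?rmorph0; ring.
Qed.

(** If 1 + be and 1 - ga both vanish, the cyclically permuted parameters
    (be, ga, al) satisfy the hypothesis of [curve_point], as 1 + ga is then 2. *)
Lemma not_finite_degenerate al be ga :
  2 != 0 :> k -> al * be * ga = 0 \/ al + be + ga + al * be * ga = 0 ->
  ~ finite_zero_locus (R al be ga).
Proof.
move=> n2 degen fin.
have H L iota x y : @transcendental_point L iota al be ga x y -> False.
  by move/not_finite_of_transcendental.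
have H2 L iota x y : @transcendental_point L iota be ga al x y -> False.
  by move=> /transcendental_point_cyc/transcendental_point_cyc/H.
have [al0|al0] := eqVneq al 0.
  by rewrite {}al0 in H; apply: H (line_point _ _ polyX_transcendental).
have [be0|be0] := eqVneq be 0.
  by rewrite {}be0 in H2; apply: H2 (line_point _ _ polyX_transcendental).
have [ga0|ga0] := eqVneq ga 0.
  rewrite {}ga0 in H; apply: (H) => //.
  exact: transcendental_point_cyc (line_point _ _ polyX_transcendental).
case: degen => [/eqP|s0].
  by rewrite !mulf_eq0 (negPf al0) (negPf be0) (negPf ga0).
have [bega|] := boolP ((1 + be != 0) || (1 - ga != 0)).
  exact: curve_point polyX_transcendental n2 al0 be0 ga0 s0 bega H.
rewrite negb_or !negbK => /andP[_ /eqP ga1].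
apply: (curve_point polyX_transcendental n2 be0 ga0 al0 _ _ H2).
  by rewrite -s0; ring.
have -> : 1 + ga = 2 - (1 - ga) by ring.
by rewrite ga1 subr0 n2.
Qed.

End Curves.

Theorem proposition3p3 (k : fieldType) (alpha beta gamma : k)
    (char_k : 2%N \notin [pchar k])
    (sqrt_m1 : exists i : k, i ^+ 2 = -1)
    (sqrt_alpha : exists a : k, a ^+ 2 = alpha)
    (sqrt_beta : exists b : k, b ^+ 2 = beta)
    (sqrt_gamma : exists c : k, c ^+ 2 = gamma) :
  finite_zero_locus (R alpha beta gamma) <->
  alpha * beta * gamma != 0 /\
  alpha + beta + gamma + alpha * beta * gamma != 0.
Proof.
have n2 : 2 != 0 :> k by move: char_k; rewrite inE.
split=> [fin|[prod0 sum0]].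
  split; apply/eqP => degen; apply: (not_finite_degenerate n2 _ fin).
    by left.
  by right.
case: sqrt_m1 sqrt_alpha sqrt_beta sqrt_gamma => i i2 [a a2] [b b2] [c c2].
apply: (finite_zero_locus_of_admissible i2 a2 b2 c2).
by move: prod0; rewrite !mulf_eq0 !negb_or => /andP[/andP[]].
Qed.
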